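(* For any given $0\le\Omega_\Lambda\le1$ and $z_0>0$ there is a smooth function $R_0(r)$, of the form $R_0(r)=cr$ with a constant $c>0$, so that for $E(r)=r^2/2$, $M(r)=r^3/2$ and $R[z]=R_{\Omega_\Lambda}[z]$, the system $$\frac{dr}{dz}=\frac{\mathcal G A R}{\mathcal G E'R-\mathcal F}-\frac{R_z\,(M\mathcal G-R)\sqrt{1+2E}}{R\,(\delta\sigma\sqrt{2E+2M/R}-\sqrt{1+2E})(\mathcal G E'R-\mathcal F)},$$ $$\frac{dt}{dz}=\frac{\delta R_z}{\delta\sigma\sqrt{2E+2M/R}-\sqrt{1+2E}},$$ $$\frac{dM}{dz}=\frac{-\mathcal F R A}{\mathcal G E'R-\mathcal F}-\frac{R_z\,(R^2E'-\mathcal F M)\sqrt{1+2E}}{R\,(\delta\sigma\sqrt{2E+2M/R}-\sqrt{1+2E})(\mathcal G E'R-\mathcal F)}$$ for $\vec X=(r,t,M)^T$, with initial conditions $$\vec X(z_0)=\left(\frac{R[z_0]}{c},\ \sqrt2\,k_c,\ \frac12\left(\frac{R[z_0]}{c}\right)^3\right)^T,$$ has a smooth solution $\vec X$ on an open interval $I\ni z_0$. (Here $M(r)=r^3/2$ enters through the initial value $M(z_0)=r(z_0)^3/2$.)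
   Context: For $0\le\Omega_\Lambda\le1$ let $\mathcal I(y)=1/\sqrt{\Omega_\Lambda+(1-\Omega_\Lambda)y^3}$ and $R_{\Omega_\Lambda}[z]=\frac1{1+z}\int_1^{1+z}\mathcal I(y)\,dy$; $R_z=dR[z]/dz$. For $c>0$, $k_c=\sqrt{c+c^2}$. A prime denotes $d/dr$. In the system, $R=R[z]$, $E=E(r(z))$, $E'=E'(r(z))$, $R_0=R_0(r(z))$, $R_0'=R_0'(r(z))$, and $\sigma=\delta=1$ (corresponding to $\partial_tR>0$, $\partial_rR>0$). Set $$B=\frac{\sigma\sqrt{2E+2M/R}}{1+z},\qquad A=B\sqrt{1+2E},$$ $$J(R,R_0,M,E,t)=\sqrt2(t-t_0)-\sigma\int_{R_0}^R\sqrt{\frac{\tau}{\tau E+M}}\,d\tau ,\qquad t_0=\sqrt2\,k_c,$$ and define $\mathcal F,\mathcal G$ by $-(\partial_RJ)\mathcal F=E'\partial_EJ+R_0'\partial_{R_0}J$ and $-(\partial_RJ)\mathcal G=\partial_MJ$. *)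

(* Defs.v *)
(* Stdlib real numbers with Coquelicot's total operators RInt, Derive. *)
From Stdlib Require Import Reals Lra.
From Coquelicot Require Import Coquelicot.
Open Scope R_scope.

Definition smooth_on (D : R -> Prop) (f : R -> R) : Prop :=
  forall (n : nat) (x : R), D x -> ex_derive_n f n x.

Definition calI (OL y : R) : R := 1 / sqrt (OL + (1 - OL) * y ^ 3).

Definition R_OL (OL z : R) : R := 1 / (1 + z) * RInt (calI OL) 1 (1 + z).

Definition k_ (c : R) : R := sqrt (c + c ^ 2).

(* The sign choices: dR/dt > 0 and dR/dr > 0. *)
Definition sigma : R := 1.
Definition delta : R := 1.

(* In all that follows the real arguments  rho, rho0, M, e, t  stand for the
   values of  R, R_0, M, E, t. *)
Definition J (t0 rho rho0 M e t : R) : R :=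
  sqrt 2 * (t - t0)
  - sigma * RInt (fun tau => sqrt (tau / (tau * e + M))) rho0 rho.

Definition dJ_R (t0 rho rho0 M e t : R) : R :=
  Derive (fun x => J t0 x rho0 M e t) rho.
Definition dJ_R0 (t0 rho rho0 M e t : R) : R :=
  Derive (fun x => J t0 rho x M e t) rho0.
Definition dJ_M (t0 rho rho0 M e t : R) : R :=
  Derive (fun x => J t0 rho rho0 x e t) M.
Definition dJ_E (t0 rho rho0 M e t : R) : R :=
  Derive (fun x => J t0 rho rho0 M x t) e.

(* The solutions of the linear equations calF_spec and calG_spec below;
   e' and rho0' stand for the values of E' and R_0'. *)
Definition calF (t0 rho rho0 M e t e' rho0' : R) : R :=
  (e' * dJ_E t0 rho rho0 M e t + rho0' * dJ_R0 t0 rho rho0 M e t)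
  / - dJ_R t0 rho rho0 M e t.
Definition calG (t0 rho rho0 M e t : R) : R :=
  dJ_M t0 rho rho0 M e t / - dJ_R t0 rho rho0 M e t.

Lemma calF_spec (t0 rho rho0 M e t e' rho0' F : R) :
  dJ_R t0 rho rho0 M e t <> 0 ->
  - dJ_R t0 rho rho0 M e t * F
    = e' * dJ_E t0 rho rho0 M e t + rho0' * dJ_R0 t0 rho rho0 M e t
  <-> F = calF t0 rho rho0 M e t e' rho0'.
Proof.
intros H; unfold calF; split; intros HF.
- rewrite <- HF; field; exact H.
- rewrite HF; field; exact H.
Qed.

Lemma calG_spec (t0 rho rho0 M e t G : R) :
  dJ_R t0 rho rho0 M e t <> 0 ->
  - dJ_R t0 rho rho0 M e t * G = dJ_M t0 rho rho0 M e t
  <-> G = calG t0 rho rho0 M e t.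
Proof.
intros H; unfold calG; split; intros HG.
- rewrite <- HG; field; exact H.
- rewrite HG; field; exact H.
Qed.

Definition B_ (z rho e M : R) : R := sigma * sqrt (2 * e + 2 * M / rho) / (1 + z).
Definition A_ (z rho e M : R) : R := B_ z rho e M * sqrt (1 + 2 * e).

Definition den1 (rho e M : R) : R :=
  delta * sigma * sqrt (2 * e + 2 * M / rho) - sqrt (1 + 2 * e).
Definition den2 (rho e' F G : R) : R := G * e' * rho - F.

(* rho_z stands for the value of R_z. *)
Definition rhs_r (z rho rho_z e e' M F G : R) : R :=
  G * A_ z rho e M * rho / den2 rho e' F G
  - rho_z * (M * G - rho) * sqrt (1 + 2 * e)
    / (rho * den1 rho e M * den2 rho e' F G).

Definition rhs_t (rho rho_z e M : R) : R := delta * rho_z / den1 rho e M.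

Definition rhs_M (z rho rho_z e e' M F G : R) : R :=
  - F * rho * A_ z rho e M / den2 rho e' F G
  - rho_z * (rho ^ 2 * e' - F * M) * sqrt (1 + 2 * e)
    / (rho * den1 rho e M * den2 rho e' F G).

(* The system at (z, r, t, M), for given functions E(r), R_0(r) and R[z], with
   derivatives r', t', M'.  Since sqrt, division, RInt and Derive are total, the
   first group of conditions records that every expression in the system is
   meaningful at this point: radicands and the integration range lie in the
   region where the formulas are defined (so that J is differentiable in each
   argument) and no denominator vanishes. *)
Definition system_at (t0 : R) (E R0 Rfun : R -> R) (z r t M r' t' M' : R) : Prop :=
  let rho := Rfun z in
  let rho_z := Derive Rfun z in
  let e := E r in
  let e' := Derive E r in
  let rho0 := R0 r in
  let rho0' := Derive R0 r in
  let F := calF t0 rho rho0 M e t e' rho0' in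
  let G := calG t0 rho rho0 M e t in
  (0 < 1 + z /\ 0 < rho /\ 0 < rho0 /\ 0 < 1 + 2 * e /\
   (forall tau : R, Rmin rho0 rho <= tau <= Rmax rho0 rho -> 0 < tau * e + M) /\
   dJ_R t0 rho rho0 M e t <> 0 /\
   den1 rho e M <> 0 /\
   den2 rho e' F G <> 0)
  /\
  (r' = rhs_r z rho rho_z e e' M F G /\
   t' = rhs_t rho rho_z e M /\
   M' = rhs_M z rho rho_z e e' M F G).

Definition smooth_solution (t0 : R) (E R0 Rfun : R -> R) (a b : R)
    (r t M : R -> R) : Prop :=
  smooth_on (fun z => a < z < b) r /\
  smooth_on (fun z => a < z < b) t /\
  smooth_on (fun z => a < z < b) M /\
  forall z : R, a < z < b ->
    system_at t0 E R0 Rfun z (r z) (t z) (M z) (Derive r z) (Derive t z) (Derive M z).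

(* Main.v *)
Require Import Defs.
From Stdlib Require Import Reals Lra Lia List.
From Coquelicot Require Import Coquelicot.
Open Scope R_scope.

(** The system is an ordinary differential equation with smooth right-hand side, as
    soon as its denominators do not vanish at the initial point; so the proof
    consists of a choice of [c], a study of the right-hand side, and local existence
    and regularity for such equations.

    The initial data satisfy [R0(r(z0)) = c r(z0) = R[z0]].  The integral in [J] is
    therefore empty at the initial point, which gives G = 0 and F = c there
    ([calG_diagonal], [calF_diagonal]), and the denominator [G E' R - F] equals [- c].
    The other denominator, [sqrt (2E + 2M/R) - sqrt (1 + 2E)], is nonzero when
    [2M/R = R^2/c^3] differs from 1; the choice [c = 1 + R[z0]^2] makes it negative
    ([den1_neg]).  All arguments of [J] are positive at the initial point, hence
    nearby.

    The right-hand side contains the derivatives of [J] in all its arguments.  The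
    substitution [tau = (M/E) s] rewrites the integral as
    [M E^(-3/2) (H(R E/M) - H(R0 E/M))] with a single smooth function [H] of one
    variable, a primitive of [sqrt (s / (s + 1))] ([J_closed]).  The derivatives of [J]
    are thereby expressions in [H], [sqrt] and the field operations.

    A function on a space of points [I -> R] is called tame at a point [p] when, near
    [p], it is Lipschitz for the sup distance and sends [n] times differentiable
    curves to [n] times differentiable functions.  Coordinates and constants are tame,
    and tameness is stable under sums, products and composition with smooth functions of
    one variable ([tame_comp]), so the right-hand side is tame
    ([tame_vector_field]).  For a tame vector field with finitely many components,
    Picard iteration gives a local solution and an induction on the order of
    differentiability makes it smooth ([tame_ode_solution]).  Applied to the four
    unknowns [z], [r], [t], [M], with [z' = 1], this yields the theorem. *)

(** * Smooth functions of one variable *)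

(** A witness derivative, rather than [Derive f], makes closure under sums,
    products and compositions a direct induction on [n].  At [n = 0] nothing is
    asked, not even continuity, so that a solution of [x' = g(x)] starts the
    bootstrap for free. *)
Fixpoint diff_n (n : nat) (U : R -> Prop) (f : R -> R) : Prop :=
  match n with
  | O => True
  | S n => exists g, (forall x, U x -> is_derive f x (g x)) /\ diff_n n U g
  end.

Definition C_infty (U : R -> Prop) (f : R -> R) : Prop :=
  forall n, diff_n n U f.

Lemma diff_n_pred n U f : diff_n (S n) U f -> diff_n n U f.
Proof.
revert f; induction n as [|n IH]; intros f; [easy|].
intros [g [Hfg Hg]]; exists g; split; [exact Hfg|now apply IH].
Qed.

Lemma diff_n_ext n U f g : open U -> (forall x, U x -> f x = g x) ->
  diff_n n U f -> diff_n n U g.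
Proof.
intros HU Heq; destruct n as [|n]; [easy|].
intros [f' [Hf Hf']]; exists f'; split; [|exact Hf'].
intros x Ux; apply (is_derive_ext_loc f); [|now apply Hf].
apply (filter_imp U); [exact Heq|now apply HU].
Qed.

Lemma diff_n_const n U (a : R) : diff_n n U (fun _ => a).
Proof.
revert a; induction n as [|n IH]; intros a; [easy|].
exists (fun _ => 0); split; [|apply IH].
intros x _; apply (is_derive_const a).
Qed.

Lemma diff_n_id n U : diff_n n U (fun x => x).
Proof.
destruct n as [|n]; [easy|].
exists (fun _ => 1); split; [|apply diff_n_const].
intros x _; apply (is_derive_id x).
Qed.

Lemma diff_n_plus n U f g : diff_n n U f -> diff_n n U g ->
  diff_n n U (fun x => f x + g x).
Proof.
revert f g; induction n as [|n IH]; intros f g; [easy|].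
intros [f' [Hf Hf']] [g' [Hg Hg']].
exists (fun x => f' x + g' x); split; [|now apply IH].
intros x Ux; apply (is_derive_plus f g); auto.
Qed.

Lemma diff_n_mult n U f g : diff_n n U f -> diff_n n U g ->
  diff_n n U (fun x => f x * g x).
Proof.
revert f g; induction n as [|n IH]; intros f g; [easy|].
intros Hf0 Hg0.
pose proof (diff_n_pred _ _ _ Hf0) as Hfn; pose proof (diff_n_pred _ _ _ Hg0) as Hgn.
destruct Hf0 as [f' [Hf Hf']]; destruct Hg0 as [g' [Hg Hg']].
exists (fun x => f' x * g x + f x * g' x); split.
- intros x Ux; apply (is_derive_mult f g); auto.
  intros; apply Rmult_comm.
- now apply diff_n_plus; apply IH.
Qed.

(** By induction on [n], with the chain rule: [(g o f)' = f' * (g' o f)] involves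
    only [g'], [f'] and [f] at order [n]. *)
Lemma diff_n_comp n U V f g :
  (forall x, U x -> V (f x)) -> diff_n n V g -> diff_n n U f ->
  diff_n n U (fun x => g (f x)).
Proof.
intros HUV; revert g; induction n as [|n IH]; intros g; [easy|].
intros [g' [Hg Hg']] Hf0; pose proof (diff_n_pred _ _ _ Hf0) as Hfn.
destruct Hf0 as [f' [Hf Hf']].
exists (fun x => f' x * g' (f x)); split.
- intros x Ux; apply (is_derive_comp g f); auto.
- apply diff_n_mult; auto.
Qed.

Lemma diff_n_ex_derive_n n U f x : open U -> diff_n n U f -> U x ->
  ex_derive_n f n x.
Proof.
intros HU; revert f x; induction n as [|n IH]; intros f x; [easy|].
intros [g [Hf Hg]] Ux.
destruct n as [|n]; [now exists (g x); apply Hf|].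
assert (Hloc : locally x (fun y => Derive f y = g y)).
{ apply (filter_imp U); [|now apply HU].
  intros y Uy; now apply is_derive_unique, Hf. }
assert (H : ex_derive_n (Derive f) (S n) x).
{ apply (ex_derive_n_ext_loc g); [|now apply IH].
  apply filter_imp with (2 := Hloc); intros y Hy; now symmetry. }
change (ex_derive (Derive_n (Derive f) n) x) in H.
change (ex_derive (Derive_n f (S n)) x).
apply ex_derive_ext with (2 := H); intros y.
rewrite <- Nat.add_1_r; exact (Derive_n_comp f n 1 y).
Qed.

Lemma C_infty_mult U f g : C_infty U f -> C_infty U g ->
  C_infty U (fun x => f x * g x).
Proof. intros Hf Hg n; now apply diff_n_mult. Qed.

Lemma C_infty_plus U f g : C_infty U f -> C_infty U g ->
  C_infty U (fun x => f x + g x).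
Proof. intros Hf Hg n; now apply diff_n_plus. Qed.

Lemma C_infty_comp U V f g : (forall x, U x -> V (f x)) ->
  C_infty V g -> C_infty U f -> C_infty U (fun x => g (f x)).
Proof. intros HUV Hg Hf n; now apply (diff_n_comp n U V). Qed.

Lemma C_infty_const U (a : R) : C_infty U (fun _ => a).
Proof. intros n; apply diff_n_const. Qed.

Lemma C_infty_id U : C_infty U (fun x => x).
Proof. intros n; apply diff_n_id. Qed.

Lemma C_infty_primitive U f F : (forall x, U x -> is_derive F x (f x)) ->
  C_infty U f -> C_infty U F.
Proof. intros HF Hf [|n]; [easy|]; exists f; split; [exact HF|apply Hf]. Qed.

Lemma C_infty_Derive U f : open U -> C_infty U f -> C_infty U (Derive f).
Proof.
intros HU Hf n; destruct (Hf (S n)) as [g [Hfg Hg]].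
apply (diff_n_ext n U g); [exact HU| |exact Hg].
intros x Ux; symmetry; now apply is_derive_unique, Hfg.
Qed.

(** [1/x] and [sqrt] satisfy first-order equations, [y' = - y^2] and
    [y' = 1/(2y)], so each order of differentiability gives the next. *)
Lemma C_infty_inv : C_infty (fun x => x <> 0) Rinv.
Proof.
intros n; induction n as [|n IH]; [easy|].
exists (fun x => (- 1) * (/ x * / x)); split.
- intros x Hx; auto_derive; [exact Hx|field; exact Hx].
- apply diff_n_mult; [apply diff_n_const|now apply diff_n_mult].
Qed.

Lemma C_infty_sqrt : C_infty (fun x => 0 < x) sqrt.
Proof.
intros n; induction n as [|n IH]; [easy|].
exists (fun x => / 2 * / sqrt x); split.
- intros x Hx; auto_derive; [exact Hx|].
  field; now apply Rgt_not_eq, sqrt_lt_R0.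
- apply diff_n_mult; [apply diff_n_const|].
  apply (diff_n_comp n _ (fun x => x <> 0)); [|apply C_infty_inv|exact IH].
  intros x Hx; now apply Rgt_not_eq, sqrt_lt_R0.
Qed.

Lemma C_infty_is_derive U f x : C_infty U f -> U x -> is_derive f x (Derive f x).
Proof.
intros Hf Ux; destruct (Hf 1%nat) as [g [Hg _]].
apply Derive_correct; exists (g x); now apply Hg.
Qed.

Lemma C_infty_continuous U f x : C_infty U f -> U x -> continuous f x.
Proof.
intros Hf Ux; apply (ex_derive_continuous (K := R_AbsRing) (V := R_NormedModule)).
exists (Derive f x); now apply (C_infty_is_derive U).
Qed.

Lemma is_derive_primitive (f : R -> R) (c s0 s : R) :
  locally s (fun r => forall q, Rmin s0 r <= q <= Rmax s0 r -> continuous f q) ->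
  continuous f s -> is_derive (fun r => c + RInt f s0 r) s (f s).
Proof.
intros Hf Hs; rewrite <- (Rplus_0_l (f s)).
apply (is_derive_plus (fun _ => c) (RInt f s0)); [apply (is_derive_const c)|].
apply (is_derive_RInt f _ s0); [|exact Hs].
apply filter_imp with (2 := Hf); intros r Hr.
apply (RInt_correct (V := R_CompleteNormedModule)).
now apply (ex_RInt_continuous (V := R_CompleteNormedModule)).
Qed.

Section Primitive.
Context (U : R -> Prop) (U_open : open U) (f : R -> R) (f_smooth : C_infty U f) (a : R).
Context (U_segment : forall x y, U x -> Rmin a x <= y <= Rmax a x -> U y).

Lemma is_derive_RInt_smooth x : U x -> is_derive (RInt f a) x (f x).
Proof.
intros Ux; apply (is_derive_ext (fun y => 0 + RInt f a y)).
- intros y; apply Rplus_0_l.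
- apply is_derive_primitive; [|now apply (C_infty_continuous U)].
  apply (filter_imp U); [|now apply U_open].
  intros y Uy q Hq; apply (C_infty_continuous U); [exact f_smooth|].
  now apply (U_segment y).
Qed.

Lemma C_infty_RInt : C_infty U (RInt f a).
Proof. apply (C_infty_primitive U f); [exact is_derive_RInt_smooth|exact f_smooth]. Qed.
End Primitive.

Lemma positive_interval a x y : 0 < a -> 0 < x -> Rmin a x <= y <= Rmax a x -> 0 < y.
Proof. unfold Rmin; destruct (Rle_dec a x); lra. Qed.

(** * Tame functions of several variables *)

Section Tame.
Context {I : Type}.
Implicit Types (p x y : I -> R) (f g : (I -> R) -> R).

Definition lipschitz_on (N : (I -> R) -> Prop) (K : R) f : Prop :=
  forall x y d, N x -> N y -> (forall i, Rabs (x i - y i) <= d) ->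
  Rabs (f x - f y) <= K * d.

(** The only smoothness of [f] that regularity of solutions calls for: it is tested
    along curves, so no partial derivatives appear, and it is inherited by
    composites from one-variable facts alone. *)
Definition preserves_diff_on (N : (I -> R) -> Prop) f : Prop :=
  forall n (U : R -> Prop) (gam : R -> I -> R), open U ->
  (forall i, diff_n n U (fun s => gam s i)) -> (forall s, U s -> N (gam s)) ->
  diff_n n U (fun s => f (gam s)).

(** Exactly what the vector field of an ordinary differential equation needs near
    the initial point: the Lipschitz bound gives a solution, the action on curves
    makes it smooth. *)
Definition tame p f : Prop :=
  exists (N : (I -> R) -> Prop) (K : R), locally p N /\ 0 <= K /\
  lipschitz_on N K f /\ preserves_diff_on N f.

Lemma lipschitz_on_continuous N K p f : locally p N -> 0 <= K ->
  lipschitz_on N K f -> continuous f p.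
Proof.
intros HN HK HL; apply filterlim_locally; intros eps.
assert (Np : N p) by now apply locally_singleton.
assert (Hd : 0 < eps / (K + 1)).
{ apply Rdiv_lt_0_compat; [apply cond_pos|lra]. }
apply filter_imp with (P := fun x => N x /\ ball p (mkposreal _ Hd) x).
- intros x [Nx Bx].
  change (Rabs (f x - f p) < eps).
  apply Rle_lt_trans with (K * (eps / (K + 1))).
  + apply HL; [exact Nx|exact Np|].
    intros i; specialize (Bx i); apply Rlt_le, Bx.
  + rewrite <- (Rmult_1_l eps) at 2.
    replace (K * (eps / (K + 1))) with ((K / (K + 1)) * eps) by (field; lra).
    apply Rmult_lt_compat_r; [apply cond_pos|].
    apply Rmult_lt_reg_r with (K + 1); [lra|]; field_simplify; lra.
- apply filter_and; [exact HN|apply locally_ball].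
Qed.

Lemma tame_continuous p f : tame p f -> continuous f p.
Proof.
intros [N [K [HN [HK [HL _]]]]]; now apply (lipschitz_on_continuous N K).
Qed.

Lemma tame_pos p f : tame p f -> 0 < f p -> locally p (fun x => 0 < f x).
Proof.
intros Hf Hp; apply (tame_continuous _ _ Hf (fun v => 0 < v)).
now apply open_gt.
Qed.

Lemma tame_neq_0 p f : tame p f -> f p <> 0 -> locally p (fun x => f x <> 0).
Proof.
intros Hf Hp; apply (tame_continuous _ _ Hf (fun v => v <> 0)).
now apply open_neq.
Qed.

Lemma tame_ext_loc p f g : locally p (fun x => f x = g x) -> tame p f -> tame p g.
Proof.
intros Heq [N [K [HN [HK [HL HD]]]]].
exists (fun x => f x = g x /\ N x), K; split; [now apply filter_and|].
split; [exact HK|split].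
- intros x y d [Hx Nx] [Hy Ny]; rewrite <- Hx, <- Hy; now apply HL.
- intros n U gam HU Hgam HUN.
  apply (diff_n_ext n U (fun s => f (gam s))); [exact HU| |].
  + intros s Us; now apply HUN.
  + apply HD; auto; intros s Us; now apply HUN.
Qed.

Lemma tame_const p (a : R) : tame p (fun _ => a).
Proof.
exists (fun _ => True), 0; split; [now apply filter_forall|].
split; [lra|split].
- intros x y d _ _ _; rewrite Rminus_diag, Rabs_R0; lra.
- intros n U gam _ _ _; apply diff_n_const.
Qed.

Lemma tame_proj p i : tame p (fun x => x i).
Proof.
exists (fun _ => True), 1; split; [now apply filter_forall|].
split; [lra|split].
- intros x y d _ _ H; rewrite Rmult_1_l; apply H.
- intros n U gam _ H _; apply H.
Qed.

Lemma tame_plus p f g : tame p f -> tame p g -> tame p (fun x => f x + g x).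
Proof.
intros [N [K [HN [HK [HL HD]]]]] [N' [K' [HN' [HK' [HL' HD']]]]].
exists (fun x => N x /\ N' x), (K + K'); split; [now apply filter_and|].
split; [lra|split].
- intros x y d [Nx N'x] [Ny N'y] H.
  replace (f x + g x - (f y + g y)) with ((f x - f y) + (g x - g y)) by ring.
  rewrite Rmult_plus_distr_r; apply Rle_trans with (1 := Rabs_triang _ _).
  apply Rplus_le_compat; auto.
- intros n U gam HU Hgam HUN; apply diff_n_plus; [apply HD|apply HD']; auto;
    intros s Us; now apply HUN.
Qed.

Lemma continuous_locally_bounded p f : continuous f p ->
  locally p (fun x => Rabs (f x) <= Rabs (f p) + 1).
Proof.
intros Hc.
apply filter_imp with (P := fun x => ball (f p) 1 (f x)).
- intros x Hx; change (Rabs (f x - f p) < 1) in Hx.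
  pose proof (Rabs_triang_inv (f x) (f p)); lra.
- apply (proj1 (filterlim_locally f (f p)) Hc (mkposreal 1 Rlt_0_1)).
Qed.

(** A product of Lipschitz functions is Lipschitz only where both are bounded, hence
    the further restriction of the neighbourhood. *)
Lemma tame_mult p f g : tame p f -> tame p g -> tame p (fun x => f x * g x).
Proof.
intros Hf Hg.
pose proof (continuous_locally_bounded _ _ (tame_continuous _ _ Hf)) as Bf.
pose proof (continuous_locally_bounded _ _ (tame_continuous _ _ Hg)) as Bg.
destruct Hf as [N [K [HN [HK [HL HD]]]]]; destruct Hg as [N' [K' [HN' [HK' [HL' HD']]]]].
set (b := Rabs (f p) + 1) in Bf; set (b' := Rabs (g p) + 1) in Bg.
exists (fun x => (N x /\ Rabs (f x) <= b) /\ (N' x /\ Rabs (g x) <= b')),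
  (b * K' + b' * K); split; [now repeat apply filter_and|].
assert (0 <= b) by (unfold b; pose proof (Rabs_pos (f p)); lra).
assert (0 <= b') by (unfold b'; pose proof (Rabs_pos (g p)); lra).
split; [apply Rplus_le_le_0_compat; now apply Rmult_le_pos|split].
- intros x y d [[Nx Bx] [N'x B'x]] [[Ny By] [N'y B'y]] Hd.
  replace (f x * g x - f y * g y) with (f x * (g x - g y) + g y * (f x - f y)) by ring.
  apply Rle_trans with (1 := Rabs_triang _ _); rewrite 2!Rabs_mult.
  rewrite Rmult_plus_distr_r, 2!Rmult_assoc.
  apply Rplus_le_compat; apply Rmult_le_compat; auto using Rabs_pos.
- intros n U gam HU Hgam HUN; apply diff_n_mult; [apply HD|apply HD']; auto;
    intros s Us; now apply HUN.
Qed.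

(** The derivative of [phi] is bounded on a small interval around [f p], so the mean
    value theorem gives a Lipschitz constant there; the values of [f] stay in that
    interval near [p]. *)
Lemma tame_comp p f V phi : open V -> C_infty V phi -> V (f p) -> tame p f ->
  tame p (fun x => phi (f x)).
Proof.
intros HV Hphi Vp Hf.
pose proof (tame_continuous _ _ Hf) as Cf.
destruct Hf as [N [K [HN [HK [HL HD]]]]].
set (b := Rabs (Derive phi (f p)) + 1).
assert (0 <= b) by (unfold b; pose proof (Rabs_pos (Derive phi (f p))); lra).
assert (HW : locally (f p) (fun v => V v /\ Rabs (Derive phi v) <= b)).
{ apply filter_and; [now apply HV|].
  assert (Hc : continuous (Derive phi) (f p)).
  { apply (C_infty_continuous V); [now apply C_infty_Derive|exact Vp]. }
  apply filter_imp with (P := fun v => ball (Derive phi (f p)) 1 (Derive phi v)).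
  - intros v Hv; change (Rabs (Derive phi v - Derive phi (f p)) < 1) in Hv.
    pose proof (Rabs_triang_inv (Derive phi v) (Derive phi (f p))); unfold b; lra.
  - apply (proj1 (filterlim_locally _ _) Hc (mkposreal 1 Rlt_0_1)). }
destruct HW as [eps HW].
assert (HW' : forall v, Rabs (v - f p) < eps -> V v /\ Rabs (Derive phi v) <= b)
  by (intros v; apply HW).
exists (fun x => N x /\ ball (f p) eps (f x)), (b * K); split.
{ apply filter_and; [exact HN|].
  apply (proj1 (filterlim_locally _ _) Cf eps). }
split; [now apply Rmult_le_pos|split].
- intros x y d [Nx Bx] [Ny By] Hd.
  change (Rabs (f x - f p) < eps) in Bx; change (Rabs (f y - f p) < eps) in By.
  assert (Hseg : forall v, Rmin (f y) (f x) <= v <= Rmax (f y) (f x) ->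
    Rabs (v - f p) < eps).
  { intros v Hv; apply Rabs_def2 in Bx; apply Rabs_def2 in By; apply Rabs_def1;
    revert Hv; unfold Rmin, Rmax; destruct (Rle_dec (f y) (f x)); lra. }
  destruct (MVT_gen phi (f y) (f x) (Derive phi)) as [v [Hv ->]].
  + intros v Hv; apply (C_infty_is_derive V); [exact Hphi|].
    apply HW', Hseg; lra.
  + intros v Hv; apply continuity_pt_filterlim.
    apply (C_infty_continuous V); [exact Hphi|now apply HW', Hseg].
  + rewrite Rabs_mult, Rmult_assoc.
    apply Rmult_le_compat; auto using Rabs_pos; now apply HW', Hseg.
- intros n U gam HU Hgam HUN.
  apply (diff_n_comp n U V (fun s => f (gam s)) phi); [|apply Hphi|].
  + intros s Us; now apply HW, HUN.
  + apply HD; auto; intros s Us; now apply HUN.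
Qed.

Lemma tame_opp p f : tame p f -> tame p (fun x => - f x).
Proof.
intros Hf; apply (tame_ext_loc p (fun x => (-1) * f x)).
- apply filter_forall; intros x; ring.
- apply tame_mult; [apply tame_const|exact Hf].
Qed.

Lemma tame_minus p f g : tame p f -> tame p g -> tame p (fun x => f x - g x).
Proof. intros Hf Hg; apply tame_plus; [exact Hf|now apply tame_opp]. Qed.

Lemma tame_div p f g : tame p f -> tame p g -> g p <> 0 ->
  tame p (fun x => f x / g x).
Proof.
intros Hf Hg Hp; apply tame_mult; [exact Hf|].
apply (tame_comp p g (fun v => v <> 0)); auto using C_infty_inv.
apply open_neq.
Qed.

Lemma tame_sqrt p f : tame p f -> 0 < f p -> tame p (fun x => sqrt (f x)).
Proof.
intros Hf Hp; apply (tame_comp p f (fun v => 0 < v)); auto using C_infty_sqrt.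
apply open_gt.
Qed.

Lemma tame_pow p f n : tame p f -> tame p (fun x => f x ^ n).
Proof.
intros Hf; induction n as [|n IH]; [apply (tame_const p 1)|].
now apply (tame_mult p f (fun x => f x ^ n)).
Qed.

End Tame.

(** * Local existence of smooth solutions *)

Lemma Rabs_RInt_le (f : R -> R) (a b M : R) :
  (forall t, Rmin a b <= t <= Rmax a b -> continuous f t) ->
  (forall t, Rmin a b <= t <= Rmax a b -> Rabs (f t) <= M) ->
  Rabs (RInt f a b) <= Rabs (b - a) * M.
Proof.
intros Hc HM.
assert (Hex : ex_RInt f a b) by now apply (ex_RInt_continuous (V := R_CompleteNormedModule)).
destruct (Rle_dec a b) as [Hab|Hab].
- rewrite Rmin_left, Rmax_right in HM by exact Hab.
  rewrite (Rabs_pos_eq (b - a)) by lra.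
  now apply abs_RInt_le_const.
- assert (Hba : b <= a) by lra.
  rewrite Rmin_right, Rmax_left in HM by exact Hba.
  rewrite <- (opp_RInt_swap f b a) by now apply ex_RInt_swap.
  change (opp ?u) with (- u); rewrite Rabs_Ropp.
  rewrite Rabs_minus_sym, (Rabs_pos_eq (a - b)) by lra.
  apply abs_RInt_le_const; auto; now apply ex_RInt_swap.
Qed.

Lemma le_geometric_0 (a C : R) : (forall n, a <= C * (1 / 2) ^ n) -> a <= 0.
Proof.
intros Ha.
assert (HL : is_lim_seq (fun n => C * (1 / 2) ^ n) 0).
{ replace (Finite 0) with (Rbar_mult C 0) by (simpl; f_equal; ring).
  apply is_lim_seq_scal_l, is_lim_seq_geom.
  rewrite Rabs_pos_eq; lra. }
exact (is_lim_seq_le _ _ (Finite a) (Finite 0) Ha (is_lim_seq_const a) HL).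
Qed.

Section Finite.
Context {I : Type} (enum : list I) (enum_full : forall i, In i enum).

Lemma finite_bound (a : I -> R) : exists b, 0 <= b /\ forall i, a i <= b.
Proof.
assert (H : exists b, 0 <= b /\ forall i, In i enum -> a i <= b).
{ clear enum_full; induction enum as [|j l IH]; [now exists 0; split; [lra|]|].
  destruct IH as [b [Hb IH]]; exists (Rmax (a j) b); split.
  - apply Rle_trans with (1 := Hb), Rmax_r.
  - intros i [<-|Hi]; [apply Rmax_l|].
    apply Rle_trans with b; [now apply IH|apply Rmax_r]. }
destruct H as [b [Hb H]]; exists b; auto.
Qed.

Lemma finite_filter {T : Type} (F : (T -> Prop) -> Prop) {FF : Filter F}
  (P : I -> T -> Prop) : (forall i, F (P i)) -> F (fun t => forall i, P i t).
Proof.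
intros HP.
apply filter_imp with (P := fun t => forall i, In i enum -> P i t); [auto|].
clear enum_full; induction enum as [|j l IH]; [now apply filter_forall|].
apply filter_imp with (2 := filter_and _ _ (HP j) IH).
intros t [H1 H2] i [<-|Hi]; auto.
Qed.

Lemma finite_continuous (X : R -> I -> R) (s : R) :
  (forall i, continuous (fun r => X r i) s) -> continuous X s.
Proof.
intros HX; apply filterlim_locally; intros eps.
apply (finite_filter (locally s) (fun i r => ball (X s i) eps (X r i))).
intros i; apply (proj1 (filterlim_locally _ _) (HX i) eps).
Qed.

Section Picard.
Context (G : I -> (I -> R) -> R) (K : R) (K_pos : 0 <= K).
Context (G_lip : forall i, lipschitz_on (fun _ => True) K (G i)).
Context (p : I -> R) (s0 : R).

Fixpoint picard (n : nat) (s : R) (i : I) : R :=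
  match n with
  | O => p i
  | S n => p i + RInt (fun r => G i (picard n r)) s0 s
  end.

(** Continuity of each component suffices only because there are finitely many: the
    topology on [I -> R] is that of uniform convergence. *)
Lemma G_continuous (X : R -> I -> R) i s :
  (forall j, continuous (fun r => X r j) s) -> continuous (fun r => G i (X r)) s.
Proof.
intros HX; apply (continuous_comp X (G i)); [now apply finite_continuous|].
apply (lipschitz_on_continuous (fun _ => True) K); auto.
now apply filter_forall.
Qed.

Lemma picard_continuous n i s : continuous (fun r => picard n r i) s.
Proof.
revert i s; induction n as [|n IH]; intros i s; [apply continuous_const|].
apply (ex_derive_continuous (K := R_AbsRing) (V := R_NormedModule)).
exists (G i (picard n s)).
apply (is_derive_primitive (fun r => G i (picard n r)));
  [apply filter_forall; intros r q _|]; now apply G_continuous.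
Qed.

(** The Picard operator contracts by a factor 1/2 on intervals with
    [K * h <= 1/2]. *)
Lemma picard_step (X Y : R -> I -> R) (h D : R) i s :
  (forall j r, Rabs (r - s0) < h -> continuous (fun q => X q j) r) ->
  (forall j r, Rabs (r - s0) < h -> continuous (fun q => Y q j) r) ->
  (forall j r, Rabs (r - s0) < h -> Rabs (X r j - Y r j) <= D) ->
  Rabs (s - s0) < h -> 0 <= D -> K * h <= 1 / 2 ->
  Rabs (RInt (fun r => G i (X r)) s0 s - RInt (fun r => G i (Y r)) s0 s)
    <= D * (1 / 2).
Proof.
intros HX HY HXY Hs HD HKh.
assert (Hin : forall r, Rmin s0 s <= r <= Rmax s0 s -> Rabs (r - s0) < h).
{ intros r Hr; apply Rabs_def2 in Hs; apply Rabs_def1; revert Hr;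
  unfold Rmin, Rmax; destruct (Rle_dec s0 s); lra. }
assert (CX : forall r, Rmin s0 s <= r <= Rmax s0 s -> continuous (fun q => G i (X q)) r)
  by (intros r Hr; apply G_continuous; intros j; apply HX; auto).
assert (CY : forall r, Rmin s0 s <= r <= Rmax s0 s -> continuous (fun q => G i (Y q)) r)
  by (intros r Hr; apply G_continuous; intros j; apply HY; auto).
change (?u - ?v) with (minus u v) at 1.
rewrite <- (RInt_minus (V := R_CompleteNormedModule)); try
  now apply (ex_RInt_continuous (V := R_CompleteNormedModule)).
apply Rle_trans with (Rabs (s - s0) * (K * D)).
- apply Rabs_RInt_le; intros r Hr.
  + apply (continuous_minus (fun q => G i (X q)) (fun q => G i (Y q))); auto.
  + apply G_lip; auto.
- apply Rle_trans with (h * (K * D)).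
  + apply Rmult_le_compat_r; [now apply Rmult_le_pos|now apply Rlt_le].
  + replace (h * (K * D)) with ((K * h) * D) by ring.
    rewrite (Rmult_comm D); now apply Rmult_le_compat_r.
Qed.

(** The iterates differ by at most [C / 2^n] at step [n], so they converge uniformly;
    the limit is continuous and, again by contraction, satisfies the integral
    equation. *)
Lemma picard_lindelof : exists (h : posreal) (X : R -> I -> R), (forall i, X s0 i = p i) /\
  forall s i, Rabs (s - s0) < h -> is_derive (fun r => X r i) s (G i (X s)).
Proof.
destruct (finite_bound (fun i => Rabs (G i p))) as [b [Hb HGp]].
assert (Hh : 0 < / (2 * (K + 1))) by (apply Rinv_0_lt_compat; lra).
set (h := / (2 * (K + 1))) in *.
assert (HKh : K * h <= 1 / 2).
{ unfold h; apply Rmult_le_reg_r with (2 * (K + 1)); [lra|].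
  field_simplify; lra. }
set (C := h * b).
assert (Hcancel : forall c u v : R, c + u - (c + v) = u - v) by (intros; ring).
assert (Hsplit : forall u v w : R, u - v = (u - w) + (w - v)) by (intros; ring).
assert (HC : 0 <= C) by (apply Rmult_le_pos; lra).
assert (Hpow : forall n, 0 <= C * (1 / 2) ^ n)
  by (intros n; apply Rmult_le_pos; [exact HC|apply pow_le; lra]).
assert (Hstep : forall n i s, Rabs (s - s0) < h ->
  Rabs (picard (S n) s i - picard n s i) <= C * (1 / 2) ^ n).
{ induction n as [|n IH]; intros i s Hs.
  - simpl; rewrite Rplus_minus_l, RInt_const; change (Rabs ((s - s0) * G i p) <= C * 1).
    rewrite Rabs_mult, Rmult_1_r; apply Rmult_le_compat; auto using Rabs_pos.
    lra.
  - change (picard (S (S n)) s i) with (p i + RInt (fun r => G i (picard (S n) r)) s0 s).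
    change (picard (S n) s i) with (p i + RInt (fun r => G i (picard n r)) s0 s).
    rewrite Hcancel.
    replace (C * (1 / 2) ^ S n) with (C * (1 / 2) ^ n * (1 / 2)) by (simpl; ring).
    apply (picard_step _ _ h); auto using picard_continuous. }
(* The factor [1 - (1/2)^k] is what makes the induction on [k] close. *)
assert (Htail : forall n k i s, Rabs (s - s0) < h ->
  Rabs (picard (n + k) s i - picard n s i) <= 2 * C * (1 / 2) ^ n * (1 - (1 / 2) ^ k)).
{ intros n k i s Hs; induction k as [|k IH].
  - rewrite Nat.add_0_r, Rminus_diag, Rabs_R0; simpl; lra.
  - rewrite Nat.add_succ_r.
    pose proof (Hstep (n + k)%nat i s Hs) as H.
    rewrite Rdef_pow_add in H.
    rewrite (Hsplit _ _ (picard (n + k) s i)).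
    apply Rle_trans with (1 := Rabs_triang _ _); simpl pow; lra. }
assert (Htail' : forall n k i s, Rabs (s - s0) < h ->
  Rabs (picard (n + k) s i - picard n s i) <= 2 * C * (1 / 2) ^ n).
{ intros n k i s Hs; apply Rle_trans with (1 := Htail n k i s Hs).
  pose proof (Hpow n); assert (0 <= (1 / 2) ^ k) by (apply pow_le; lra).
  rewrite <- (Rmult_1_r (2 * C * (1 / 2) ^ n)) at 2.
  apply Rmult_le_compat_l; lra. }
assert (Hsmall : forall eps : posreal, exists n, 2 * C * (1 / 2) ^ n < eps).
{ intros eps.
  assert (HL : is_lim_seq (fun n => 2 * C * (1 / 2) ^ n) 0).
  { replace (Finite 0) with (Rbar_mult (2 * C) 0) by (simpl; f_equal; ring).
    apply is_lim_seq_scal_l, is_lim_seq_geom; rewrite Rabs_pos_eq; lra. }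
  apply is_lim_seq_spec in HL; destruct (HL eps) as [n Hn]; exists n.
  specialize (Hn n (Nat.le_refl n)); apply Rabs_def2 in Hn; lra. }
set (X := fun s i => real (Lim_seq (fun n => picard n s i))).
assert (Hlim : forall i s, Rabs (s - s0) < h ->
  is_lim_seq (fun n => picard n s i) (X s i)).
{ intros i s Hs; apply Lim_seq_correct', ex_lim_seq_cauchy_corr.
  intros eps; destruct (Hsmall (pos_div_2 eps)) as [n Hn]; exists n.
  simpl in Hn.
  intros m m' Hm Hm'.
  replace m with (n + (m - n))%nat by lia; replace m' with (n + (m' - n))%nat by lia.
  pose proof (Htail' n (m - n)%nat i s Hs) as H1.
  pose proof (Htail' n (m' - n)%nat i s Hs) as H2.
  rewrite Rabs_minus_sym in H2.
  rewrite (Hsplit _ _ (picard n s i)).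
  apply Rle_lt_trans with (1 := Rabs_triang _ _); lra. }
assert (Hdist : forall n i s, Rabs (s - s0) < h ->
  Rabs (X s i - picard n s i) <= 2 * C * (1 / 2) ^ n).
{ intros n i s Hs.
  apply (is_lim_seq_le (fun k => Rabs (picard (n + k) s i - picard n s i))
           (fun _ => 2 * C * (1 / 2) ^ n) (Finite (Rabs (X s i - picard n s i)))
           (Finite (2 * C * (1 / 2) ^ n)));
    [intros k; now apply Htail'| |apply is_lim_seq_const].
  apply (is_lim_seq_abs _ (Finite (X s i - picard n s i))).
  apply is_lim_seq_minus'; [|apply is_lim_seq_const].
  apply (is_lim_seq_ext (fun k => picard (k + n) s i)).
  - intros k; now rewrite Nat.add_comm.
  - apply (proj1 (is_lim_seq_incr_n (fun k => picard k s i) n _)), Hlim, Hs. }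
assert (HXc : forall i s, Rabs (s - s0) < h -> continuous (fun r => X r i) s).
{ intros i s Hs; apply continuity_pt_filterlim.
  apply (CVU_continuity (fun n r => picard n r i) _ s0 (mkposreal h Hh)).
  - intros eps Heps; destruct (Hsmall (mkposreal eps Heps)) as [N HN].
    exists N; intros n y HnN Hy.
    apply Rle_lt_trans with (1 := Hdist n i y Hy).
    apply Rle_lt_trans with (2 := HN); simpl.
    replace n with (N + (n - N))%nat by lia; rewrite Rdef_pow_add.
    rewrite <- Rmult_assoc.
    rewrite <- (Rmult_1_r (2 * C * (1 / 2) ^ N)) at 2.
    apply Rmult_le_compat_l; [pose proof (Hpow N); lra|].
    apply Rle_trans with (1 ^ (n - N)); [apply pow_incr; lra|rewrite pow1; lra].
  - intros n y _; apply continuity_pt_filterlim, picard_continuous.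
  - exact Hs. }
assert (Hint : forall i s, Rabs (s - s0) < h ->
  X s i = p i + RInt (fun r => G i (X r)) s0 s).
{ intros i s Hs.
  apply Rminus_diag_uniq, Rabs_eq_0, Rle_antisym; [|apply Rabs_pos].
  apply (le_geometric_0 _ (2 * C)); intros n.
  pose proof (Hdist (S n) i s Hs) as H1; simpl in H1.
  assert (H2 := picard_step X (picard n) h (2 * C * (1 / 2) ^ n) i s HXc
    (fun j r _ => picard_continuous n j r) (fun j r => Hdist n j r) Hs).
  assert (0 <= 2 * C * (1 / 2) ^ n) by (pose proof (Hpow n); lra).
  specialize (H2 H HKh); rewrite Rabs_minus_sym in H2.
  rewrite (Hsplit _ _ (p i + RInt (fun r => G i (picard n r)) s0 s)), Hcancel.
  apply Rle_trans with (1 := Rabs_triang _ _); lra. }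
exists (mkposreal h Hh), X; split.
- intros i; rewrite Hint, RInt_point by now rewrite Rminus_diag, Rabs_R0.
  apply Rplus_0_r.
- intros s i Hs.
  assert (Hnear : forall r, Rabs (r - s0) < h -> locally r (fun q => Rabs (q - s0) < h)).
  { intros r Hr; assert (Hd : 0 < h - Rabs (r - s0)) by lra.
    exists (mkposreal _ Hd); intros q Hq.
    change (Rabs (q - r) < h - Rabs (r - s0)) in Hq.
    rewrite (Hsplit q s0 r); apply Rle_lt_trans with (1 := Rabs_triang _ _); lra. }
  assert (Hc : forall r, Rabs (r - s0) < h -> continuous (fun q => G i (X q)) r)
    by (intros r Hr; apply G_continuous; intros j; now apply HXc).
  apply (is_derive_ext_loc (fun r => p i + RInt (fun q => G i (X q)) s0 r)).
  + apply filter_imp with (2 := Hnear s Hs); intros r Hr; symmetry; now apply Hint.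
  + apply is_derive_primitive; [|now apply Hc].
    apply filter_imp with (2 := Hnear s Hs); intros r Hr q Hq; apply Hc.
    apply Rabs_def2 in Hr; apply Rabs_def1; revert Hq;
      unfold Rmin, Rmax; destruct (Rle_dec s0 r); lra.
Qed.
End Picard.

Lemma finite_tame (g : I -> (I -> R) -> R) (p : I -> R) : (forall i, tame p (g i)) ->
  exists N K, locally p N /\ 0 <= K /\
  forall i, lipschitz_on N K (g i) /\ preserves_diff_on N (g i).
Proof.
intros Hg.
assert (H : exists N K, locally p N /\ 0 <= K /\
  forall i, In i enum -> lipschitz_on N K (g i) /\ preserves_diff_on N (g i)).
{ clear enum_full; induction enum as [|j l IH].
  - exists (fun _ => True), 0; split; [now apply filter_forall|split; [lra|easy]].
  - destruct (Hg j) as [N [K [HN [HK [HL HD]]]]].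
    destruct IH as [N' [K' [HN' [HK' IH]]]].
    exists (fun x => N x /\ N' x), (Rmax K K'); split; [now apply filter_and|].
    split; [now apply Rle_trans with (2 := Rmax_l K K')|].
    assert (Hmono : forall i M k, (forall x, N x /\ N' x -> M x) -> k <= Rmax K K' ->
      lipschitz_on M k (g i) -> lipschitz_on (fun x => N x /\ N' x) (Rmax K K') (g i)).
    { intros i M k HM Hk Hi x y d Nx Ny Hd.
      apply Rle_trans with (k * d); [apply Hi; auto|].
      apply Rmult_le_compat_r; [|exact Hk].
      apply Rle_trans with (2 := Hd i), Rabs_pos. }
    intros i [<-|Hi].
    + split; [apply (Hmono j N K); auto using Rmax_l; now intros x []|].
      intros n U gam HU Hgam HUN; apply HD; auto; intros s Us; now apply HUN.
    + destruct (IH i Hi) as [HL' HD'].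
      split; [apply (Hmono i N' K'); auto using Rmax_r; now intros x []|].
      intros n U gam HU Hgam HUN; apply HD'; auto; intros s Us; now apply HUN. }
destruct H as [N [K [HN [HK H]]]]; exists N, K; auto.
Qed.

Definition clamp (e c v : R) : R := Rmax (c - e) (Rmin (c + e) v).

Lemma clamp_lipschitz e c u v : Rabs (clamp e c u - clamp e c v) <= Rabs (u - v).
Proof.
unfold clamp, Rmin, Rmax, Rabs.
repeat (destruct Rle_dec); repeat (destruct Rcase_abs); lra.
Qed.

Lemma clamp_range e c v : 0 <= e -> Rabs (clamp e c v - c) <= e.
Proof.
intros He; apply Rabs_le; unfold clamp, Rmin, Rmax; repeat (destruct Rle_dec); lra.
Qed.

Lemma clamp_id e c v : Rabs (v - c) <= e -> clamp e c v = v.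
Proof.
intros H; apply Rabs_le_between in H.
unfold clamp, Rmin, Rmax; repeat (destruct Rle_dec); lra.
Qed.

(** Composing with the retraction onto a box around [p] makes the vector field
    globally Lipschitz, so that the Picard iterates need not be confined.  The
    solution agrees with one of the original field as long as it stays in the box.
    Smoothness follows by bootstrapping: if all components are [n] times
    differentiable, so are their derivatives [g i (X s)].  The predicate [Q] carries
    side conditions of the equation that hold near [p] along the solution. *)
Theorem tame_ode_solution (g : I -> (I -> R) -> R) (p : I -> R)
  (Q : (I -> R) -> Prop) (s0 : R) :
  (forall i, tame p (g i)) -> locally p Q ->
  exists (a b : R) (X : R -> I -> R), a < s0 < b /\ (forall i, X s0 i = p i) /\
  (forall i, C_infty (fun s => a < s < b) (fun s => X s i)) /\
  forall s, a < s < b -> Q (X s) /\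
    forall i, is_derive (fun r => X r i) s (g i (X s)).
Proof.
intros Hg HQ.
destruct (finite_tame g p Hg) as [N [K [HN [HK HLD]]]].
destruct (filter_and _ _ HN HQ) as [eps Heps].
set (e := pos_div_2 eps).
assert (Hball : forall x, (forall i, Rabs (x i - p i) <= e) -> N x /\ Q x).
{ intros x Hx; apply Heps; intros i.
  apply Rle_lt_trans with (1 := Hx i); simpl; pose proof (cond_pos eps); lra. }
set (cl := fun (x : I -> R) i => clamp e (p i) (x i)).
assert (Ncl : forall x, N (cl x)).
{ intros x; apply Hball; intros i; apply clamp_range, Rlt_le, cond_pos. }
destruct (picard_lindelof (fun i x => g i (cl x)) K HK) with (p := p) (s0 := s0)
  as [h [X [HX0 HX]]].
{ intros i x y d _ _ Hd; apply (proj1 (HLD i)); auto.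
  intros j; apply Rle_trans with (2 := Hd j), clamp_lipschitz. }
assert (Hnear : locally s0 (fun s => Rabs (s - s0) < h /\
  forall i, Rabs (X s i - p i) < e)).
{ apply filter_and; [now exists h|].
  apply (finite_filter (locally s0) (fun i s => Rabs (X s i - p i) < e)); intros i.
  assert (Hc : continuous (fun s => X s i) s0).
  { apply (ex_derive_continuous (K := R_AbsRing) (V := R_NormedModule)).
    exists (g i (cl (X s0))); apply HX; rewrite Rminus_diag, Rabs_R0; apply cond_pos. }
  rewrite <- (HX0 i).
  apply (proj1 (filterlim_locally _ _) Hc e). }
destruct Hnear as [d Hd].
assert (Hin : forall s, s0 - d < s < s0 + d -> Rabs (s - s0) < h /\
  forall i, Rabs (X s i - p i) < e).
{ intros s Hs; apply Hd, Rabs_def1; simpl in *; unfold minus, plus, opp; simpl; lra. }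
assert (HNQ : forall s, s0 - d < s < s0 + d -> N (X s) /\ Q (X s)).
{ intros s Hs; apply Hball; intros i; now apply Rlt_le, Hin. }
assert (HXg : forall s, s0 - d < s < s0 + d ->
  forall i, is_derive (fun r => X r i) s (g i (X s))).
{ intros s Hs i.
  (* [cl (X s)] and [X s] agree pointwise; the Lipschitz bound with distance 0
     turns this into equality of the values *)
  replace (g i (X s)) with (g i (cl (X s))); [now apply HX, Hin|].
  apply Rminus_diag_uniq, Rabs_eq_0, Rle_antisym; [|apply Rabs_pos].
  rewrite <- (Rmult_0_r K); apply (proj1 (HLD i)); [apply Ncl|now apply HNQ|].
  intros j; unfold cl; rewrite clamp_id by now apply Rlt_le, Hin.
  rewrite Rminus_diag, Rabs_R0; lra. }
pose proof (cond_pos d) as Hdpos.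
exists (s0 - d), (s0 + d), X; split; [lra|split; [exact HX0|split]].
- intros i n; revert i; induction n as [|n IH]; intros i; [easy|].
  exists (fun s => g i (X s)); split; [intros s Hs; now apply HXg|].
  apply (proj2 (HLD i)); [apply open_and; [apply open_gt|apply open_lt]|exact IH|].
  intros s Hs; now apply HNQ.
- intros s Hs; split; [now apply HNQ|now apply HXg].
Qed.
End Finite.

(** * The derivatives of J *)

(** The substitution [tau = (M/e) s] turns the integrand of [J] into the
    parameter-free function [sqrt (s / (s + 1))], up to a factor.  The derivatives
    of [J] in the parameters [M] and [e] are then ordinary derivatives of one
    function of one variable, and no differentiation under the integral sign is
    needed. *)
Definition profile (s : R) : R := sqrt (s / (s + 1)).
Definition profile_int (x : R) : R := RInt profile 1 x.

Lemma C_infty_profile : C_infty (fun s => 0 < s) profile.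
Proof.
apply (C_infty_comp _ (fun v => 0 < v) (fun s => s / (s + 1)) sqrt);
  [intros s Hs; apply Rdiv_lt_0_compat; lra|apply C_infty_sqrt|].
apply C_infty_mult; [apply C_infty_id|].
apply (C_infty_comp _ (fun v => v <> 0) (fun s => s + 1) Rinv);
  [intros s Hs; lra|apply C_infty_inv|].
apply C_infty_plus; [apply C_infty_id|apply C_infty_const].
Qed.

Lemma C_infty_profile_int : C_infty (fun s => 0 < s) profile_int.
Proof.
apply C_infty_RInt; [apply open_gt|exact C_infty_profile|].
intros x y Hx; apply positive_interval; lra.
Qed.

Lemma is_derive_profile_int x : 0 < x -> is_derive profile_int x (profile x).
Proof.
apply (is_derive_RInt_smooth (fun s => 0 < s));
  [apply open_gt|exact C_infty_profile|].
intros y z Hy; apply positive_interval; lra.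
Qed.

Lemma Derive_profile_int x : 0 < x -> Derive (fun y : R => profile_int y) x = profile x.
Proof. intros Hx; now apply is_derive_unique, is_derive_profile_int. Qed.

Lemma ex_derive_profile_int x : 0 < x -> ex_derive (fun y : R => profile_int y) x.
Proof. intros Hx; exists (profile x); now apply is_derive_profile_int. Qed.

Lemma profile_scale tau e M : 0 < tau -> 0 < e -> 0 < M ->
  profile (tau * e / M) = sqrt e * sqrt (tau / (tau * e + M)).
Proof.
intros Ht He HM; unfold profile.
assert (0 < tau * e) by now apply Rmult_lt_0_compat.
rewrite <- sqrt_mult_alt by lra.
f_equal; field; lra.
Qed.

(** The scaled function [M / (e sqrt e) * profile_int (tau * e / M)] is a primitive in
    [tau] of the integrand, by [profile_scale]. *)
Lemma J_closed t0 rho rho0 M e t : 0 < rho -> 0 < rho0 -> 0 < M -> 0 < e ->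
  J t0 rho rho0 M e t = sqrt 2 * (t - t0)
    - M / (e * sqrt e) * (profile_int (rho * e / M) - profile_int (rho0 * e / M)).
Proof.
intros Hr Hr0 HM He.
unfold J, sigma; rewrite Rmult_1_l; f_equal.
assert (Hse : 0 < sqrt e) by now apply sqrt_lt_R0.
rewrite Rmult_minus_distr_l.
apply is_RInt_unique.
apply (is_RInt_derive (fun tau => M / (e * sqrt e) * profile_int (tau * e / M))).
- intros tau Htau.
  assert (Ht : 0 < tau) by now apply (positive_interval rho0 rho).
  assert (Hx : 0 < tau * e / M)
    by (apply Rdiv_lt_0_compat; [now apply Rmult_lt_0_compat|exact HM]).
  auto_derive; [now apply ex_derive_profile_int|].
  fold (tau * e / M); rewrite Derive_profile_int, profile_scale by assumption.
  field; repeat split; now apply Rgt_not_eq.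
- intros tau Htau.
  assert (Ht : 0 < tau) by now apply (positive_interval rho0 rho).
  assert (0 < tau * e) by now apply Rmult_lt_0_compat.
  apply (ex_derive_continuous (K := R_AbsRing) (V := R_NormedModule)).
  auto_derive; split; [lra|split; [|easy]].
  apply Rmult_lt_0_compat; [exact Ht|apply Rinv_0_lt_compat; lra].
Qed.

Lemma scaled_pos rho e M : 0 < rho -> 0 < e -> 0 < M -> 0 < rho * e / M.
Proof.
intros Hr He HM; apply Rdiv_lt_0_compat; [now apply Rmult_lt_0_compat|exact HM].
Qed.

Lemma locally_positive v : 0 < v -> locally v (fun w => 0 < w).
Proof. exact (open_gt 0 v). Qed.

Section Derivatives.
Context (t0 rho rho0 M e t : R).
Context (Hrho : 0 < rho) (Hrho0 : 0 < rho0) (HM : 0 < M) (He : 0 < e).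

Let x := rho * e / M.
Let x0 := rho0 * e / M.

(* [auto_derive] writes quotients as products, hence the [fold]s *)
Ltac derive_closed :=
  assert (Hx : 0 < x) by (now apply scaled_pos);
  assert (Hx0 : 0 < x0) by (now apply scaled_pos);
  assert (Hse : 0 < sqrt e) by (now apply sqrt_lt_R0);
  assert (Hsq : sqrt e * sqrt e = e) by (apply sqrt_sqrt; lra);
  apply is_derive_unique; auto_derive;
  [ repeat split; try (now apply ex_derive_profile_int);
    try apply Rmult_integral_contrapositive_currified; now try apply Rgt_not_eq
  | fold (rho * e / M); fold (rho0 * e / M); fold x; fold x0;
    rewrite ?(Derive_profile_int _ Hx), ?(Derive_profile_int _ Hx0) ].

Lemma dJ_R_closed : dJ_R t0 rho rho0 M e t = - (profile x / sqrt e).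
Proof.
unfold dJ_R.
rewrite (Derive_ext_loc _ (fun r => sqrt 2 * (t - t0)
    - M / (e * sqrt e) * (profile_int (r * e / M) - profile_int (rho0 * e / M)))).
- derive_closed; field; repeat split; now apply Rgt_not_eq.
- apply filter_imp with (2 := locally_positive _ Hrho).
  intros r Hr; now apply J_closed.
Qed.

Lemma dJ_R0_closed : dJ_R0 t0 rho rho0 M e t = profile x0 / sqrt e.
Proof.
unfold dJ_R0.
rewrite (Derive_ext_loc _ (fun r => sqrt 2 * (t - t0)
    - M / (e * sqrt e) * (profile_int (rho * e / M) - profile_int (r * e / M)))).
- derive_closed; field; repeat split; now apply Rgt_not_eq.
- apply filter_imp with (2 := locally_positive _ Hrho0).
  intros r Hr; now apply J_closed.
Qed.

Lemma dJ_M_closed : dJ_M t0 rho rho0 M e t =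
  - ((profile_int x - x * profile x) - (profile_int x0 - x0 * profile x0)) / (e * sqrt e).
Proof.
unfold dJ_M.
rewrite (Derive_ext_loc _ (fun m => sqrt 2 * (t - t0)
    - m / (e * sqrt e) * (profile_int (rho * e / m) - profile_int (rho0 * e / m)))).
- derive_closed.
  generalize (profile_int x) (profile x) (profile_int x0) (profile x0); intros P P' P0 P0'.
  unfold x, x0; field; repeat split; now apply Rgt_not_eq.
- apply filter_imp with (2 := locally_positive _ HM).
  intros m Hm; now apply J_closed.
Qed.

Lemma dJ_E_closed : dJ_E t0 rho rho0 M e t =
  M * ((3 / 2 * profile_int x - x * profile x) - (3 / 2 * profile_int x0 - x0 * profile x0))
    / (e ^ 2 * sqrt e).
Proof.
unfold dJ_E.
rewrite (Derive_ext_loc _ (fun u => sqrt 2 * (t - t0)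
    - M / (u * sqrt u) * (profile_int (rho * u / M) - profile_int (rho0 * u / M)))).
- derive_closed.
  generalize (profile_int x) (profile x) (profile_int x0) (profile x0); intros P P' P0 P0'.
  unfold x, x0; clear x x0 Hx Hx0.
  (* [e] is replaced by the square of [sqrt e], which makes the identity rational *)
  set (s := sqrt e) in *; clearbody s; rewrite <- Hsq.
  field; repeat split; now apply Rgt_not_eq.
- apply filter_imp with (2 := locally_positive _ He).
  intros u Hu; now apply J_closed.
Qed.
End Derivatives.

Lemma tame_profile {I} (p : I -> R) f : tame p f -> 0 < f p ->
  tame p (fun q => profile (f q)).
Proof.
intros Hf Hp; apply (tame_comp p f (fun v => 0 < v)); auto using C_infty_profile.
apply open_gt.
Qed.

Lemma tame_profile_int {I} (p : I -> R) f : tame p f -> 0 < f p ->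
  tame p (fun q => profile_int (f q)).
Proof.
intros Hf Hp; apply (tame_comp p f (fun v => 0 < v)); auto using C_infty_profile_int.
apply open_gt.
Qed.

(* Decomposes a real expression in a point along its arithmetic structure; what
   remains are the nonvanishing and positivity conditions at [p], and functions
   that are not built by arithmetic. *)
Ltac tame_step := first
  [ assumption
  | apply tame_const
  | apply tame_proj
  | lazymatch goal with
    | |- tame ?p (fun q => @?f q + @?g q) => apply (tame_plus p f g)
    | |- tame ?p (fun q => @?f q - @?g q) => apply (tame_minus p f g)
    | |- tame ?p (fun q => @?f q * @?g q) => apply (tame_mult p f g)
    | |- tame ?p (fun q => @?f q / @?g q) => apply (tame_div p f g)
    | |- tame ?p (fun q => - @?f q) => apply (tame_opp p f)
    | |- tame ?p (fun q => (@?f q) ^ ?n) => apply (tame_pow p f n)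
    | |- tame ?p (fun q => sqrt (@?f q)) => apply (tame_sqrt p f)
    | |- tame ?p (fun q => profile (@?f q)) => apply (tame_profile p f)
    | |- tame ?p (fun q => profile_int (@?f q)) => apply (tame_profile_int p f)
    end ].
Ltac prove_tame := repeat tame_step.

Section TameJ.
Context {I : Type} (p : I -> R) (t0 : R) (rho rho0 M e : (I -> R) -> R) (t : (I -> R) -> R).
Context (Trho : tame p rho) (Trho0 : tame p rho0) (TM : tame p M) (Te : tame p e).
Context (Hrho : 0 < rho p) (Hrho0 : 0 < rho0 p) (HM : 0 < M p) (He : 0 < e p).

Lemma all_positive_near : locally p (fun q =>
  (0 < rho q /\ 0 < rho0 q) /\ (0 < M q /\ 0 < e q)).
Proof. now repeat apply filter_and; apply tame_pos. Qed.

Lemma sqrt_e_pos : 0 < sqrt (e p).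
Proof. now apply sqrt_lt_R0. Qed.

Ltac side := pose proof sqrt_e_pos; try apply Rgt_not_eq;
  repeat (first [assumption | apply pow_lt | apply Rdiv_lt_0_compat | apply Rmult_lt_0_compat]).

Lemma tame_dJ_R : tame p (fun q => dJ_R t0 (rho q) (rho0 q) (M q) (e q) (t q)).
Proof.
apply (tame_ext_loc p (fun q => - (profile (rho q * e q / M q) / sqrt (e q)))).
- apply filter_imp with (2 := all_positive_near); intros q Hq.
  now rewrite dJ_R_closed.
- prove_tame; side.
Qed.

Lemma tame_dJ_R0 : tame p (fun q => dJ_R0 t0 (rho q) (rho0 q) (M q) (e q) (t q)).
Proof.
apply (tame_ext_loc p (fun q => profile (rho0 q * e q / M q) / sqrt (e q))).
- apply filter_imp with (2 := all_positive_near); intros q Hq.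
  now rewrite dJ_R0_closed.
- prove_tame; side.
Qed.

Lemma tame_dJ_M : tame p (fun q => dJ_M t0 (rho q) (rho0 q) (M q) (e q) (t q)).
Proof.
apply (tame_ext_loc p (fun q =>
  - ((profile_int (rho q * e q / M q)
      - rho q * e q / M q * profile (rho q * e q / M q))
     - (profile_int (rho0 q * e q / M q)
        - rho0 q * e q / M q * profile (rho0 q * e q / M q)))
  / (e q * sqrt (e q)))).
- apply filter_imp with (2 := all_positive_near); intros q Hq.
  now rewrite dJ_M_closed.
- prove_tame; side.
Qed.

Lemma tame_dJ_E : tame p (fun q => dJ_E t0 (rho q) (rho0 q) (M q) (e q) (t q)).
Proof.
apply (tame_ext_loc p (fun q =>
  M q * ((3 / 2 * profile_int (rho q * e q / M q)
          - rho q * e q / M q * profile (rho q * e q / M q))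
         - (3 / 2 * profile_int (rho0 q * e q / M q)
            - rho0 q * e q / M q * profile (rho0 q * e q / M q)))
  / (e q ^ 2 * sqrt (e q)))).
- apply filter_imp with (2 := all_positive_near); intros q Hq.
  now rewrite dJ_E_closed.
- prove_tame; side.
Qed.

End TameJ.

Lemma profile_pos x : 0 < x -> 0 < profile x.
Proof. intros Hx; apply sqrt_lt_R0, Rdiv_lt_0_compat; lra. Qed.

Lemma dJ_R_neg t0 rho rho0 M e t : 0 < rho -> 0 < rho0 -> 0 < M -> 0 < e ->
  dJ_R t0 rho rho0 M e t < 0.
Proof.
intros Hr Hr0 HM He; rewrite dJ_R_closed by assumption.
apply Ropp_lt_gt_0_contravar, Rdiv_lt_0_compat; [|now apply sqrt_lt_R0].
now apply profile_pos, scaled_pos.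
Qed.

(** On the diagonal [rho = rho0] the integral in [J] is over an empty interval, so its
    derivatives in [M] and [e] vanish and those in the two end points are opposite.
    These are the values of G and F at the initial point. *)
Lemma calG_diagonal t0 rho M e t : 0 < rho -> 0 < M -> 0 < e ->
  calG t0 rho rho M e t = 0.
Proof.
intros Hr HM He; unfold calG; rewrite dJ_M_closed by assumption.
rewrite Rminus_diag, Ropp_0; unfold Rdiv; ring.
Qed.

Lemma calF_diagonal t0 rho M e t e' c : 0 < rho -> 0 < M -> 0 < e ->
  calF t0 rho rho M e t e' c = c.
Proof.
intros Hr HM He; unfold calF.
rewrite dJ_E_closed, dJ_R_closed, dJ_R0_closed by assumption.
assert (0 < profile (rho * e / M)) by (now apply profile_pos, scaled_pos).
assert (0 < sqrt e) by now apply sqrt_lt_R0.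
field; repeat split; now apply Rgt_not_eq.
Qed.

(** * The distance function R[z] *)

Section Background.
Context (OL : R) (HOL : 0 <= OL <= 1).

Lemma calI_radicand_pos y : 0 < y -> 0 < OL + (1 - OL) * y ^ 3.
Proof.
intros Hy; assert (Hy3 : 0 < y ^ 3) by now apply pow_lt.
destruct (Req_dec OL 0) as [->|H]; [lra|].
assert (0 <= (1 - OL) * y ^ 3) by (apply Rmult_le_pos; lra); lra.
Qed.

Lemma C_infty_calI : C_infty (fun y => 0 < y) (calI OL).
Proof.
apply C_infty_mult; [apply C_infty_const|].
apply (C_infty_comp _ (fun v => v <> 0)
         (fun y => sqrt (OL + (1 - OL) * y ^ 3)) Rinv); [|exact C_infty_inv|].
- intros y Hy; now apply Rgt_not_eq, sqrt_lt_R0, calI_radicand_pos.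
- apply (C_infty_comp _ (fun v => 0 < v)
           (fun y => OL + (1 - OL) * y ^ 3) sqrt); [exact calI_radicand_pos|exact C_infty_sqrt|].
  apply C_infty_plus, C_infty_mult; try apply C_infty_const.
  repeat apply C_infty_mult; try apply C_infty_id; apply C_infty_const.
Qed.

Lemma C_infty_R_OL : C_infty (fun z => -1 < z) (R_OL OL).
Proof.
assert (H1z : C_infty (fun z => -1 < z) (fun z => 1 + z))
  by (apply C_infty_plus; [apply C_infty_const|apply C_infty_id]).
apply C_infty_mult.
- apply C_infty_mult; [apply C_infty_const|].
  apply (C_infty_comp _ (fun v => v <> 0) (fun z => 1 + z) Rinv);
    [intros z Hz; lra|exact C_infty_inv|exact H1z].
- apply (C_infty_comp _ (fun y => 0 < y) (fun z => 1 + z) (RInt (calI OL) 1));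
    [intros z Hz; lra| |exact H1z].
  apply C_infty_RInt; [apply open_gt|exact C_infty_calI|].
  intros x y Hx; apply positive_interval; lra.
Qed.

Lemma R_OL_pos z : 0 < z -> 0 < R_OL OL z.
Proof.
intros Hz; apply Rmult_lt_0_compat; [apply Rdiv_lt_0_compat; lra|].
apply RInt_gt_0; [lra| |].
- intros y Hy; apply Rdiv_lt_0_compat; [lra|].
  apply sqrt_lt_R0, calI_radicand_pos; lra.
- intros y Hy; apply (C_infty_continuous (fun v => 0 < v)); [exact C_infty_calI|lra].
Qed.
End Background.

(** * The system as a vector field *)

(** The independent variable [z] is made an unknown with equation [z' = 1], which turns
    the system into an autonomous one. *)
Inductive coord := cz | cr | ct | cm.

Section VectorField.
Context (Rfun : R -> R) (c t0 : R).

Definition E_ (x : coord -> R) : R := x cr ^ 2 / 2.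
Definition F_ (x : coord -> R) : R :=
  calF t0 (Rfun (x cz)) (c * x cr) (x cm) (E_ x) (x ct) (x cr) c.
Definition G_ (x : coord -> R) : R :=
  calG t0 (Rfun (x cz)) (c * x cr) (x cm) (E_ x) (x ct).

Definition vector_field (i : coord) (x : coord -> R) : R :=
  match i with
  | cz => 1
  | cr => rhs_r (x cz) (Rfun (x cz)) (Derive Rfun (x cz)) (E_ x) (x cr) (x cm)
            (F_ x) (G_ x)
  | ct => rhs_t (Rfun (x cz)) (Derive Rfun (x cz)) (E_ x) (x cm)
  | cm => rhs_M (x cz) (Rfun (x cz)) (Derive Rfun (x cz)) (E_ x) (x cr) (x cm)
            (F_ x) (G_ x)
  end.

Context (p : coord -> R) (U : R -> Prop) (U_open : open U).
Context (Rfun_smooth : C_infty U Rfun) (Up : U (p cz)).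
Context (z_pos : 0 < 1 + p cz) (Rfun_pos : 0 < Rfun (p cz)).
Context (c_pos : 0 < c) (r_pos : 0 < p cr) (M_pos : 0 < p cm).
Context (den1_neq : den1 (Rfun (p cz)) (E_ p) (p cm) <> 0).
Context (den2_neq : den2 (Rfun (p cz)) (p cr) (F_ p) (G_ p) <> 0).

Let T_rho : tame p (fun x => Rfun (x cz)).
Proof. apply (tame_comp p (fun x => x cz) U); auto using tame_proj. Qed.

Let T_rho_z : tame p (fun x => Derive Rfun (x cz)).
Proof. apply (tame_comp p (fun x => x cz) U); auto using tame_proj, C_infty_Derive. Qed.

Let T_E : tame p E_.
Proof. unfold E_; prove_tame; lra. Qed.

Let E_pos : 0 < E_ p.
Proof. unfold E_; assert (0 < p cr ^ 2) by (now apply pow_lt); lra. Qed.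

Let T_rho0 : tame p (fun x => c * x cr).
Proof. prove_tame. Qed.

Let rho0_pos : 0 < c * p cr.
Proof. now apply Rmult_lt_0_compat. Qed.

Let dJ_R_neq : - dJ_R t0 (Rfun (p cz)) (c * p cr) (p cm) (E_ p) (p ct) <> 0.
Proof. apply Ropp_neq_0_compat, Rlt_not_eq, dJ_R_neg; assumption. Qed.

Let T_F : tame p F_.
Proof.
unfold F_, calF; prove_tame.
- apply tame_dJ_E; auto; prove_tame.
- apply tame_dJ_R0; auto; prove_tame.
- apply tame_dJ_R; auto; prove_tame.
Qed.

Let T_G : tame p G_.
Proof.
unfold G_, calG; prove_tame.
- apply tame_dJ_M; auto; prove_tame.
- apply tame_dJ_R; auto; prove_tame.
Qed.

Let T_den1 : tame p (fun x => den1 (Rfun (x cz)) (E_ x) (x cm)).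
Proof.
unfold den1, delta, sigma; prove_tame; try lra.
assert (0 < 2 * p cm / Rfun (p cz)) by (apply Rdiv_lt_0_compat; lra).
lra.
Qed.

Let T_den2 : tame p (fun x => den2 (Rfun (x cz)) (x cr) (F_ x) (G_ x)).
Proof. unfold den2; prove_tame. Qed.

Lemma tame_vector_field i : tame p (vector_field i).
Proof.
assert (0 < 2 * p cm / Rfun (p cz)) by (apply Rdiv_lt_0_compat; lra).
destruct i; unfold vector_field, rhs_r, rhs_t, rhs_M, A_, B_, delta, sigma; prove_tame;
  auto; try lra;
  repeat apply Rmult_integral_contrapositive_currified; auto; lra.
Qed.

(** These open conditions imply the side conditions of the system: positivity of the
    radicand [tau * e + M] and nonvanishing of [dJ_R] follow from positivity of
    all the arguments. *)
Definition admissible (x : coord -> R) : Prop :=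
  (0 < 1 + x cz /\ 0 < Rfun (x cz)) /\ (0 < x cr /\ 0 < x cm) /\
  den1 (Rfun (x cz)) (E_ x) (x cm) <> 0 /\
  den2 (Rfun (x cz)) (x cr) (F_ x) (G_ x) <> 0.

Lemma admissible_near : locally p admissible.
Proof.
repeat apply filter_and.
- apply tame_pos; auto; prove_tame.
- now apply tame_pos.
- apply tame_pos; auto; prove_tame.
- apply tame_pos; auto; prove_tame.
- now apply tame_neq_0.
- now apply tame_neq_0.
Qed.
End VectorField.

Lemma Derive_half_square r : Derive (fun x => x ^ 2 / 2) r = r.
Proof. apply is_derive_unique; auto_derive; [easy|field]. Qed.

Lemma Derive_linear c r : Derive (fun x => c * x) r = c.
Proof. apply is_derive_unique; auto_derive; [easy|ring]. Qed.

Lemma admissible_system_at Rfun c t0 (x : coord -> R) : 0 < c ->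
  admissible Rfun c t0 x ->
  system_at t0 (fun x => x ^ 2 / 2) (fun r => c * r) Rfun (x cz) (x cr) (x ct) (x cm)
    (vector_field Rfun c t0 cr x) (vector_field Rfun c t0 ct x) (vector_field Rfun c t0 cm x).
Proof.
intros Hc [[Hz HR] [[Hr HM] [Hd1 Hd2]]]; unfold system_at.
rewrite Derive_half_square, Derive_linear.
change (x cr ^ 2 / 2) with (E_ x).
assert (HE : 0 < E_ x) by (unfold E_; assert (0 < x cr ^ 2) by (now apply pow_lt); lra).
assert (Hr0 : 0 < c * x cr) by now apply Rmult_lt_0_compat.
repeat split; try assumption; try lra.
- intros tau Htau.
  assert (0 < tau) by (now apply (positive_interval (c * x cr) (Rfun (x cz)))).
  assert (0 < tau * E_ x) by (now apply Rmult_lt_0_compat); lra.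
- now apply Rlt_not_eq, dJ_R_neg.
Qed.

(** [den1] compares [sqrt (r^2 + 2M/rho)] with [sqrt (r^2 + 1)]. *)
Lemma den1_neg rho r M : 0 < rho -> 0 < M -> 2 * M < rho -> den1 rho (r ^ 2 / 2) M < 0.
Proof.
intros Hrho HM HMr; unfold den1, delta, sigma.
rewrite 2!Rmult_1_l; apply Rlt_minus, sqrt_lt_1_alt.
assert (0 <= r ^ 2) by (rewrite <- Rsqr_pow2; apply Rle_0_sqr).
assert (0 < 2 * M / rho) by (apply Rdiv_lt_0_compat; lra).
assert (2 * M / rho < 1) by (apply Rmult_lt_reg_r with rho; [lra|]; field_simplify; lra).
lra.
Qed.

(** * Existence of the solution *)

Theorem theorem3 (OL z0 : R) (HOL : 0 <= OL <= 1) (Hz0 : 0 < z0) :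
  exists (R0 : R -> R) (c : R),
    smooth_on (fun _ => True) R0 /\
    0 < c /\
    (forall r : R, R0 r = c * r) /\
    exists (a b : R) (r t M : R -> R),
      a < z0 < b /\
      smooth_solution (sqrt 2 * k_ c) (fun x => x ^ 2 / 2) R0 (R_OL OL) a b r t M /\
      r z0 = R_OL OL z0 / c /\
      t z0 = sqrt 2 * k_ c /\
      M z0 = 1 / 2 * (R_OL OL z0 / c) ^ 3.
Proof.
pose proof (R_OL_pos OL HOL z0 Hz0) as HR.
set (rho := R_OL OL z0) in *.
(* At the initial point [2M/rho = rho^2/c^3], and [den1] vanishes exactly when this
   is 1; this choice of [c] makes [c^3 > rho^2]. *)
set (c := 1 + rho ^ 2).
assert (Hrho2 : 0 < rho ^ 2) by now apply pow_lt.
assert (Hc : 0 < c) by (unfold c; lra).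
exists (fun r => c * r), c.
split; [|split; [exact Hc|split; [easy|]]].
{ intros n x _; apply (diff_n_ex_derive_n n (fun _ => True)); [apply open_true| |easy].
  apply diff_n_mult; [apply diff_n_const|apply diff_n_id]. }
set (t0 := sqrt 2 * k_ c).
set (p := fun i => match i with
  | cz => z0 | cr => rho / c | ct => t0 | cm => 1 / 2 * (rho / c) ^ 3 end).
assert (Hr : 0 < rho / c) by now apply Rdiv_lt_0_compat.
assert (HM : 0 < 1 / 2 * (rho / c) ^ 3) by (apply Rmult_lt_0_compat; [lra|now apply pow_lt]).
assert (Hcr : c * (rho / c) = rho) by (field; lra).
assert (HE : 0 < E_ p).
{ unfold E_; simpl p; assert (0 < (rho / c) ^ 2) by (now apply pow_lt); lra. }
assert (HMrho : 2 * (1 / 2 * (rho / c) ^ 3) < rho).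
{ assert (Hu : 0 < rho ^ 2 / c < 1).
  { split; [now apply Rdiv_lt_0_compat|].
    apply Rmult_lt_reg_r with c; [exact Hc|].
    unfold Rdiv; rewrite Rmult_assoc, Rinv_l by lra; unfold c; lra. }
  assert (Hv : 0 < / c < 1).
  { split; [now apply Rinv_0_lt_compat|].
    rewrite <- Rinv_1; apply Rinv_lt_contravar; unfold c; lra. }
  replace (2 * (1 / 2 * (rho / c) ^ 3)) with (rho * (rho ^ 2 / c * (/ c * / c)))
    by (field; lra).
  rewrite <- (Rmult_1_r rho) at 3.
  apply Rmult_lt_compat_l; [exact HR|nra]. }
assert (Hd1 : den1 (R_OL OL (p cz)) (E_ p) (p cm) <> 0)
  by (now apply Rlt_not_eq, den1_neg).
assert (Hd2 : den2 (R_OL OL (p cz)) (p cr) (F_ (R_OL OL) c t0 p) (G_ (R_OL OL) c t0 p) <> 0).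
{ (* here G = 0 and F = c, hence [den2 = - c] *)
  unfold den2, F_, G_; simpl p; fold rho; rewrite Hcr.
  rewrite calF_diagonal, calG_diagonal by assumption; lra. }
assert (enum_full : forall i, In i (cz :: cr :: ct :: cm :: nil)) by (intros []; simpl; tauto).
pose proof (open_gt (-1)) as HU.
pose proof (C_infty_R_OL OL HOL) as HRs.
destruct (tame_ode_solution (cz :: cr :: ct :: cm :: nil) enum_full
  (vector_field (R_OL OL) c t0) p (admissible (R_OL OL) c t0) z0) as [a [b [X [Hab [HX0 [HXs HX]]]]]].
{ intros i; apply (tame_vector_field _ _ _ _ (fun z => -1 < z)); auto; simpl; lra. }
{ apply (admissible_near _ _ _ _ (fun z => -1 < z)); auto; simpl; lra. }
assert (HXz : forall s, a < s < b -> X s cz = s).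
{ intros s Hs.
  destruct (MVT_gen (fun r => X r cz) z0 s (fun _ => 1)) as [v [_ Hv]].
  - intros r Hr'; refine (proj2 (HX r _) cz).
    revert Hr'; unfold Rmin, Rmax; destruct (Rle_dec z0 s); lra.
  - intros r Hr'; apply continuity_pt_filterlim.
    apply (C_infty_continuous _ (fun r => X r cz) r (HXs cz)).
    revert Hr'; unfold Rmin, Rmax; destruct (Rle_dec z0 s); lra.
  - rewrite (HX0 cz) in Hv; simpl in Hv; lra. }
assert (Hopen : open (fun s => a < s < b))
  by (apply open_and; [apply open_gt|apply open_lt]).
exists a, b, (fun s => X s cr), (fun s => X s ct), (fun s => X s cm).
split; [exact Hab|split; [|exact (conj (HX0 cr) (conj (HX0 ct) (HX0 cm)))]].
assert (Hsm : forall i, smooth_on (fun s => a < s < b) (fun s => X s i)).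
{ intros i n s Hs; apply (diff_n_ex_derive_n n _ _ s Hopen); [apply HXs|exact Hs]. }
split; [apply Hsm|split; [apply Hsm|split; [apply Hsm|]]].
intros s Hs; destruct (HX s Hs) as [HQ HD].
assert (HDX : forall i, Derive (fun s => X s i) s = vector_field (R_OL OL) c t0 i (X s))
  by (intros i; apply is_derive_unique, HD).
rewrite !HDX.
pose proof (admissible_system_at _ _ _ _ Hc HQ) as Hsys.
now rewrite (HXz s Hs) in Hsys.
Qed.
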